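(* Let $d$ be an integer with $1\le d\leq 17$. Then for every nonempty subset $\Gamma\subset \mathcal I_d$ one has $\det M_\Gamma>0$.
   Context: For a positive integer $d$, let $\mathcal I_d$ be the set of all triples $\boldsymbol i=(i,j,k)$ of non-negative integers with $i+j+k=d$; it has $\binom{d+2}{2}$ elements. For a triangle $T$ in the plane, points are written in barycentric coordinates $\boldsymbol v=(u,v,w)$, $u+v+w=1$, with respect to $T$. The Bernstein basis polynomials of total degree $d$ are $B^d_{\boldsymbol i}(\boldsymbol v):=\frac{d!}{i!\,j!\,k!}u^iv^jw^k$ for $\boldsymbol i=(i,j,k)\in\mathcal I_d$, with the convention $0^0=1$. The domain points are $\xi_{\boldsymbol i}:=\boldsymbol i/d=(i/d,j/d,k/d)$ (barycentric coordinates), $\boldsymbol i\in\mathcal I_d$. For a nonempty $\Gamma\subset\mathcal I_d$, $M_\Gamma:=[B^d_{\boldsymbol j}(\xi_{\boldsymbol i})]_{\boldsymbol i,\boldsymbol j\in\Gamma}$ is the $|\Gamma|\times|\Gamma|$ matrix with rows indexed by $\boldsymbol i\in\Gamma$ and columns by $\boldsymbol j\in\Gamma$, using the same ordering of $\Gamma$ for rows and columns (the determinant does not depend on this ordering). The inclusion $\Gamma\subset\mathcal I_d$ is not necessarily strict. *)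

(* Defs.v *)
From mathcomp Require Import all_boot all_order all_algebra.

Set Implicit Arguments.
Unset Strict Implicit.
Unset Printing Implicit Defensive.

Import Order.TTheory GRing.Theory Num.Theory.
Local Open Scope ring_scope.

(* Triples (i, j, k), written ((i, j), k). The bounds i, j, k <= d only serve
   to make the type finite: they follow from i + j + k = d. *)
Notation triple d := ('I_d.+1 * 'I_d.+1 * 'I_d.+1)%type.

Definition indices (d : nat) : {set triple d} :=
  [set t : triple d | (t.1.1 + t.1.2 + t.2 == d)%N].

(* The argument (u, v, w) is meant to be a triple of barycentric coordinates,
   u + v + w = 1; the formula makes sense on all of R^3. The convention
   0^0 = 1 is built into ^+. *)
Definition bernstein (R : realFieldType) (d : nat) (t : triple d)
    (x : R * R * R) : R :=
  let: (i, j, k) := t in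
  let: (u, v, w) := x in
  d`!%:R / (i`! * j`! * k`!)%N%:R * u ^+ i * v ^+ j * w ^+ k.

Definition domain_point (R : realFieldType) (d : nat) (t : triple d) :
    R * R * R :=
  let: (i, j, k) := t in (i%:R / d%:R, j%:R / d%:R, k%:R / d%:R).

Lemma domain_point_barycentric (R : realFieldType) (d : nat) (t : triple d) :
  (0 < d)%N -> t \in indices d ->
  let x := domain_point R t in x.1.1 + x.1.2 + x.2 = 1.
Proof.
case: t => [[i j] k] d_gt0; rewrite inE /= => /eqP sum_d.
by rewrite -!mulrDl -!natrD sum_d divff // pnatr_eq0 -lt0n.
Qed.

(* Rows and columns are both ordered by the enumeration of G. *)
Definition bernstein_mx (R : realFieldType) (d : nat) (G : {set triple d}) :
    'M[R]_#|G| :=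
  \matrix_(a, b) bernstein (enum_val b) (domain_point R (enum_val a)).

(* Main.v *)
Require Import Defs.
From Stdlib Require Import ZArith.
From mathcomp Require Import all_boot all_order all_algebra.
From mathcomp Require Import zify ssrZ ring lra.

(** The matrix [M] of [G] is a P-matrix: for every nonzero vector [x] some
    coordinate satisfies [0 < x_a * (M x)_a].  A square matrix with this
    property has a positive determinant, by induction on the size: the first
    pivot is positive and the Schur complement inherits the property
    ([det_sign_keeping]).  Unlike positive definiteness of the symmetric part,
    the property survives positive scalings of the rows and of the columns,
    and the coordinate [a] may be looked for in any part of the matrix, which
    may depend on [x].

    Up to a positive scaling of the columns, the entry of [M] at the triples
    [s, t] is [s ^ t := s1 ^ t1 * s2 ^ t2 * s3 ^ t3], which vanishes unless
    the nonzero coordinates of [t] are among those of [s].  Given [x], take a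
    triple with a nonzero entry of [x] and as few nonzero coordinates as
    possible, and let [F] be the relatively open face of the triangle that
    contains it: in the rows of [F], only the columns of [F] contribute to
    [M x].  It remains to find a row [s] of [F] with
    [0 < f s * \sum_(t in F) s ^ t * f t], where [f] is the rescaled [x], and
    for this it suffices that
        [0 < \sum_(s in F) \sum_(t in F) g s * s ^ t * f s * f t]
    for some positive weights [g].

    The weights are [g s = s1! * s2! * s3!].  By the formula of Stirling,
    [g s] is [s ^ s] times a slowly varying factor, so that [g s * s ^ t] is
    close to [s ^ (s + t)]; the quotient of [s ^ (s + t)] and [t ^ (s + t)] is
    [1] up to terms of third order in [s - t], because [s] and [t] have the
    same sum.  The matrix [g s * s ^ t] is thus nearly symmetric where its
    entries are large, and its symmetric part looks like a Gaussian kernel on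
    a triangular lattice.  For [d <= 17] this symmetric part is positive
    definite on every face; that is established by computation
    ([faces_positive_le17]).

    The computation is a Cholesky factorization in fixed-point integer
    arithmetic ([cholesky]).  The Schur complements are updated exactly, and
    only the entries of each new row of the factor are rounded.  The error of
    a row is dominated by a multiple of the identity that is set aside from
    its own pivot and from the later ones, so that the success of the
    factorization is by itself a lower bound for the quadratic form
    ([cholesky_sound]). *)

Set Implicit Arguments.
Unset Strict Implicit.
Unset Printing Implicit Defensive.

Import Order.TTheory GRing.Theory Num.Theory.
Local Open Scope ring_scope.

(** * P-matrices *)

(** Fiedler and Pták's characterization of the P-matrices, the matrices all of
    whose principal minors are positive. *)
Definition sign_keeping (R : realFieldType) n (A : 'M[R]_n) :=
  forall x : 'cV_n, x != 0 -> exists i, 0 < x i 0 * (A *m x) i 0.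

(** For [x] orthogonal to the first row, the first coordinate of [A x] vanishes
    and the other ones are those of the Schur complement applied to the rest of
    [x]; hence the Schur complement has the property as well. *)
Lemma det_sign_keeping (R : realFieldType) n (A : 'M[R]_n) :
  sign_keeping A -> 0 < \det A.
Proof.
elim: n A => [|n IHn] A A_sk; first by rewrite det_mx00.
rewrite -[n.+1]/(1 + n)%N in A A_sk *.
pose a := ulsubmx A 0 0; pose b := ursubmx A.
pose c := dlsubmx A; pose D := drsubmx A.
have defA : A = block_mx a%:M b c D by rewrite -mx11_scalar submxK.
have block_sk (y : R) (x : 'cV_n) : (y != 0) || (x != 0) ->
    0 < y * (a * y + (b *m x) 0 0) \/
    exists i, 0 < x i 0 * (c *m y%:M + D *m x) i 0.
  move=> yx_neq0; have [|i] := A_sk (col_mx y%:M x).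
    rewrite col_mx_eq0 negb_and; case/orP: yx_neq0 => [y_neq0|->]; last first.
      by rewrite orbT.
    apply/orP; left; apply: contra y_neq0 => /eqP/matrixP/(_ 0 0).
    by rewrite !mxE mulr1n => ->.
  rewrite {1}defA mul_block_col; case: (split_ordP i) => j ->.
    rewrite !col_mxEu !ord1 !mxE big_ord1 !mxE eqxx !mulr1n.
    by left.
  by rewrite !col_mxEd; right; exists j.
have a_gt0 : 0 < a.
  have [||[i]] := block_sk 1 0; rewrite ?oner_neq0 // ?mulmx0.
    by rewrite mxE addr0 mulr1 mul1r.
  by rewrite mxE mul0r ltxx.
have a_neq0 : a != 0 by rewrite gt_eqF.
pose S := D - a^-1 *: (c *m b).
have S_sk : sign_keeping S.
  move=> x x_neq0; pose y := - (a^-1 * (b *m x) 0 0).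
  have y_root : a * y + (b *m x) 0 0 = 0 by rewrite /y mulrN mulVKf // addNr.
  have [||[i]] := block_sk y x; first by rewrite x_neq0 orbT.
    by rewrite y_root mulr0 ltxx.
  suff -> : c *m y%:M + D *m x = S *m x :> 'cV_n by exists i.
  rewrite /S mulmxBl -scalemxAl -mulmxA [b *m x]mx11_scalar.
  by rewrite !mul_mx_scalar /y scaleNr scalerA addrC.
have detA : \det A = a * \det S.
  have : A *m block_mx 1%:M (- (a^-1 *: b)) 0 1%:M = block_mx a%:M 0 c S.
    rewrite {1}defA mulmx_block !mulmx1 !mulmx0 !addr0 !mulmxN -!scalemxAr.
    rewrite mul_scalar_mx scalerA mulVf // scale1r addNr.
    by rewrite /S addrC.
  move/(congr1 determinant); rewrite det_mulmx det_ublock det_lblock !det1.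
  by rewrite !mulr1 det_scalar1.
by rewrite detA mulr_gt0 // IHn.
Qed.

(** * Cholesky factorization with rounding *)

Section Cholesky.

(** The rows of the Cholesky factor are computed with an absolute error of at
    most [B] in the entries of the factored matrix. *)
Variable B : Z.

Fixpoint sub_scaled (y : Z) (v row : seq Z) : seq Z :=
  match v, row with
  | z :: v', a :: row' => Z.sub a (Z.mul y z) :: sub_scaled y v' row'
  | _, _ => [::]
  end.

Fixpoint schur (v : seq Z) (T : seq (seq Z)) : seq (seq Z) :=
  match v, T with
  | y :: v', row :: T' => sub_scaled y v row :: schur v' T'
  | _, _ => [::]
  end.

(** A symmetric matrix is given by the rows of its upper triangle.  The row of
    the factor is [r :: v], with [v] the rounded quotient [b / r], and
    [b = r * v + e] with [0 <= e < r <= B].  In the quadratic form, the error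
    [e] costs at most [B * (n' * y ^+ 2 + |x| ^+ 2)], for [y] the first
    variable and [x] the vector of the [n'] other ones.  The first term is
    paid by [slack], which is taken off the pivot [a], the second one by the
    increase of [s], the multiple of the identity that the remaining form must
    dominate.  The value of [r] matters only through the tests made on it. *)
Fixpoint cholesky (n : nat) (s : Z) (T : seq (seq Z)) : bool :=
  match n, T with
  | n'.+1, (a :: b) :: T' =>
    let slack := Z.add s (Z.mul B (Z.of_nat n')) in
    let r := Z.sqrt (Z.sub a slack) in
    [&& Z.ltb 0 r, Z.leb r B, Z.leb (Z.add (Z.mul r r) slack) a
      & cholesky n' (Z.add s B) (schur [seq Z.div x r | x <- b] T')]
  | n'.+1, _ => false
  | 0, _ => true
  end.

Fixpoint upper_triangular (T : seq (seq Z)) : bool :=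
  if T is row :: T' then (size row == (size T').+1) && upper_triangular T'
  else true.

Variable R : realFieldType.

Definition Zr (z : Z) : R := (int_of_Z z)%:~R.

Lemma ZrD : {morph Zr : x y / Z.add x y >-> x + y}.
Proof. by move=> x y; rewrite /Zr -[Z.add x y]/(x + y) !rmorphD. Qed.

Lemma ZrM : {morph Zr : x y / Z.mul x y >-> x * y}.
Proof. by move=> x y; rewrite /Zr -[Z.mul x y]/(x * y) !rmorphM. Qed.

Lemma ZrB : {morph Zr : x y / Z.sub x y >-> x - y}.
Proof. by move=> x y; rewrite /Zr -[Z.sub x y]/(x - y) !rmorphB. Qed.

Lemma Zr_nat n : Zr (Z.of_nat n) = n%:R.
Proof. by rewrite /Zr (_ : int_of_Z _ = n%:Z) //; lia. Qed.

Lemma Zr_le x y : Z.leb x y -> Zr x <= Zr y.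
Proof. by move=> le_xy; rewrite ler_int; lia. Qed.

Lemma Zr_lt x y : Z.ltb x y -> Zr x < Zr y.
Proof. by move=> le_xy; rewrite ltr_int; lia. Qed.

Fixpoint dot (v : seq Z) (x : seq R) : R :=
  match v, x with
  | a :: v', y :: x' => Zr a * y + dot v' x'
  | _, _ => 0
  end.

Fixpoint qform (T : seq (seq Z)) (x : seq R) : R :=
  match T, x with
  | row :: T', y :: x' =>
    y * (Zr (head Z0 row) * y + 2 * dot (behead row) x') + qform T' x'
  | _, _ => 0
  end.

Fixpoint normsq (x : seq R) : R :=
  if x is y :: x' then y ^+ 2 + normsq x' else 0.

Lemma dot_sub_scaled y v row x :
  size v = size x -> size row = size x ->
  dot (sub_scaled y v row) x = dot row x - Zr y * dot v x.
Proof.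
elim: v row x => [|z v IHv] [|a row] [|t x] //=; first by rewrite mulr0 subr0.
by move=> [szv] [szr]; rewrite IHv // ZrB ZrM; ring.
Qed.

(** The update is exact for every [v], be it a rounded row or not; this is why
    rounding errors do not propagate. *)
Lemma qform_schur v T x :
  upper_triangular T -> size v = size T -> size x = size T ->
  qform (schur v T) x = qform T x - dot v x ^+ 2.
Proof.
elim: T v x => [|row T IHT] [|y v] [|t x] //=; first by rewrite expr0n subr0.
case/andP=> /eqP szrow utT [szv] [szx].
rewrite IHT //; case: row szrow => [//|a b] [szb] /=.
by rewrite dot_sub_scaled ?szv ?szb // ZrB ZrM; ring.
Qed.

Lemma size_sub_scaled y v row :
  size (sub_scaled y v row) = minn (size v) (size row).
Proof.
by elim: v row => [|z v IHv] [|a row] //=; rewrite ?minn0 // IHv minnSS.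
Qed.

Lemma upper_triangular_schur v T :
  upper_triangular T -> size v = size T ->
  size (schur v T) = size T /\ upper_triangular (schur v T).
Proof.
elim: T v => [|row T IHT] [|y v] //= /andP[/eqP szrow utT] [szv].
have [-> ->] := IHT v utT szv; split=> //.
case: row szrow => [//|a b] [szb] /=.
by rewrite size_sub_scaled szb szv minnn eqxx.
Qed.

(** For one entry with remainder [e], [0 <= e <= B], the bound follows from
    [0 <= e * (y + t) ^+ 2]. *)
Lemma dot_remainder (r : Z) (b : seq Z) (y : R) (x : seq R) :
  Z.ltb 0 r -> Z.leb r B -> size b = size x ->
  let v := [seq Z.div z r | z <- b] in
  - Zr B * ((size x)%:R * y ^+ 2 + normsq x) <=
    2 * y * (dot b x - Zr r * dot v x).
Proof.
move=> r_gt0 r_le_B; elim: b x => [|z b IHb] [|t x] //=.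
  by rewrite mul0r !(addr0, subr0, mulr0).
move=> [szb]; have := IHb x szb => /= {}IHb.
set e := Zr z - Zr r * Zr (Z.div z r).
have e_ge0 : 0 <= e.
  by rewrite subr_ge0 -ZrM Zr_le //; apply/Z.leb_le/Z.mul_div_le; lia.
have e_leB : e <= Zr B.
  rewrite /e -ZrM -ZrB Zr_le //; have := Z.mod_pos_bound z r.
  by have := Z_div_mod_eq_full z r; lia.
have sq_ge0 := mulr_ge0 e_ge0 (sqr_ge0 (y + t)).
have Be_ge0 : 0 <= (Zr B - e) * (y ^+ 2 + t ^+ 2).
  by rewrite mulr_ge0 ?subr_ge0 // addr_ge0 ?sqr_ge0.
have -> : 2 * y * (Zr z * t + dot b x -
    Zr r * (Zr (Z.div z r) * t + dot [seq Z.div z r | z <- b] x)) =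
  2 * y * e * t + 2 * y * (dot b x - Zr r * dot [seq Z.div z r | z <- b] x).
  by rewrite /e; ring.
rewrite -natr1; move: IHb sq_ge0 Be_ge0; lra.
Qed.

(** With [r], [v] and [e] as in [cholesky], the form is
    [(r y + v.x)^2 + (a - r^2) y^2 + 2 y (e.x)] plus the form of the updated
    matrix at [x]; the first square is dropped, the second term is at least
    [slack * y ^+ 2], the third is bounded by [dot_remainder] and the last one
    by induction. *)
Lemma cholesky_sound n s T x :
  upper_triangular T -> size T = n -> size x = n -> cholesky n s T ->
  Zr s * normsq x <= qform T x.
Proof.
elim: n s T x => [|n IHn] s [|[//|a b] T] [|y x] //=; first by rewrite mulr0.
move=> /andP[/eqP[szb] utT] [szT] [szx] /and4P[].
set slack := Z.add s _; set r := Z.sqrt _ => r_gt0 r_le_B r_slack chol.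
set v := [seq Z.div z r | z <- b] in chol.
have szv : size v = size T by rewrite size_map szb.
have [sz_schur ut_schur] := upper_triangular_schur utT szv.
have := IHn _ _ x ut_schur _ szx chol; rewrite sz_schur szT => /(_ erefl).
rewrite qform_schur ?szx // ZrD => schur_ge.
have := @dot_remainder r b y x r_gt0 r_le_B _; rewrite szb szT szx -/v.
move=> /(_ erefl) /= rem_ge.
have := Zr_le r_slack; rewrite !ZrD !ZrM Zr_nat => diag_ge.
have := ler_wpM2r (sqr_ge0 y) diag_ge.
have := sqr_ge0 (Zr r * y + dot v x).
move: rem_ge schur_ge; lra.
Qed.

End Cholesky.

(** * Quadratic forms over finite families *)

Fixpoint gram (A : Type) (f : A -> A -> Z) (l : seq A) : seq (seq Z) :=
  if l is u :: l' then [seq f u v | v <- l] :: gram f l' else [::].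

Lemma size_gram A (f : A -> A -> Z) l : size (gram f l) = size l.
Proof. by elim: l => //= u l ->. Qed.

Lemma upper_triangular_gram A (f : A -> A -> Z) l :
  upper_triangular (gram f l).
Proof. by elim: l => //= u l ->; rewrite size_map size_gram eqxx. Qed.

Section Gram.

Variable R : realFieldType.
Local Notation Zr := (Zr R).

Lemma dot_map A (f : A -> Z) (x : A -> R) l :
  dot (map f l) (map x l) = \sum_(v <- l) Zr (f v) * x v.
Proof. by elim: l => [|u l IHl] /=; rewrite ?big_nil // big_cons IHl. Qed.

Lemma normsq_map A (x : A -> R) l : normsq (map x l) = \sum_(v <- l) x v ^+ 2.
Proof. by elim: l => [|u l IHl] /=; rewrite ?big_nil // big_cons IHl. Qed.

Lemma qform_gram A (f : A -> A -> Z) (x : A -> R) l :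
  (forall u v, f u v = f v u) ->
  qform (gram f l) (map x l) =
  \sum_(u <- l) \sum_(v <- l) Zr (f u v) * (x u * x v).
Proof.
move=> fC; elim: l => [|u l IHl] /=; first by rewrite big_nil.
rewrite IHl dot_map big_cons [in RHS]big_cons.
under [X in _ = _ + X]eq_bigr => v _ do rewrite big_cons.
rewrite big_split /= addrA; congr (_ + _).
have sumu : x u * (\sum_(v <- l) Zr (f u v) * x v) =
            \sum_(v <- l) Zr (f u v) * (x u * x v).
  by rewrite mulr_sumr; apply: eq_bigr => v _; ring.
have -> : \sum_(v <- l) Zr (f v u) * (x v * x u) =
          \sum_(v <- l) Zr (f u v) * (x u * x v).
  by apply: eq_bigr => v _; rewrite fC [x v * _]mulrC.
by rewrite -sumu; ring.
Qed.

(** This bound accounts for the rounding of the entries of a matrix to integers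
    before its factorization. *)
Lemma perturbation_ge A (e : A -> A -> R) (x : A -> R) l :
  (forall u v, `|e u v| <= 1) ->
  - (size l)%:R * \sum_(u <- l) x u ^+ 2 <=
  \sum_(u <- l) \sum_(v <- l) e u v * (x u * x v).
Proof.
move=> e_le1; set N := \sum_(u <- l) x u ^+ 2.
have sum_const c : \sum_(u <- l) c = c * (size l)%:R :> R.
  by rewrite big_const_seq count_predT iter_addr_0 mulr_natr.
have -> : - (size l)%:R * N =
    \sum_(u <- l) \sum_(v <- l) - ((x u ^+ 2 + x v ^+ 2) / 2).
  under eq_bigr => u _ do
    rewrite sumrN -mulr_suml big_split /= sum_const -/N.
  by rewrite sumrN -mulr_suml big_split /= -mulr_suml sum_const -/N; lra.
apply: ler_sum => u _; apply: ler_sum => v _.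
have /andP[e_geN1 e_le] : -1 <= e u v <= 1 by rewrite -ler_norml.
have : 0 <= (1 + e u v) * (x u + x v) ^+ 2.
  by rewrite mulr_ge0 ?sqr_ge0 //; lra.
have : 0 <= (1 - e u v) * (x u - x v) ^+ 2.
  by rewrite mulr_ge0 ?sqr_ge0 //; lra.
lra.
Qed.

End Gram.

(** * Positivity on the faces, by computation *)

Definition ntriple := (nat * nat * nat)%type.

Definition powers (n : nat) (a : Z) : seq Z :=
  (fix loop n z := if n is n'.+1 then z :: loop n' (Z.mul a z) else [::])
    n Z.one.

Definition power_table (d : nat) : seq (seq Z) :=
  [seq powers d.+1 (Z.of_nat a) | a <- iota 0 d.+1].

Definition zfact (n : nat) : Z :=
  (fix loop n := if n is n'.+1 then Z.mul (Z.of_nat n) (loop n') else Z.one) n.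

Section Face.

(** [tab] is meant to be [power_table d]: it is a parameter in order that the
    powers be computed once for each [d]. *)
Variables (d : nat) (tab : seq (seq Z)).

Definition tab_pow (a b : nat) : Z := nth Z0 (nth [::] tab a) b.

Definition monomial (s t : ntriple) : Z :=
  let: (i, j, k) := s in let: (i', j', k') := t in
  Z.mul (Z.mul (tab_pow i i') (tab_pow j j')) (tab_pow k k').

(** A triple with data that depend on it alone and are computed once: its
    weight [g] and a scaling factor. *)
Definition node := (ntriple * Z * Z)%type.
Definition pt (u : node) : ntriple := u.1.1.
Definition weight (u : node) : Z := u.1.2.
Definition scale (u : node) : Z := u.2.

Definition weighted (u v : node) : Z :=
  Z.mul (weight u) (monomial (pt u) (pt v)).

(** The symmetric part of [weighted] has diagonal entries of very different
    sizes.  The factors [scale] bring the diagonal of [entry] close to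
    [2 ^ (2 * (d + 10))], so that the Cholesky factor has entries of at most
    [2 ^ (d + 10)]: the exponent [6 * d + 30] is the sum of [2 * (d + 10)] and
    of the shift [4 * d + 10] in [entry].  For [d = 17] the least eigenvalue of
    the symmetric part on the open triangle, normalized to have a diagonal of
    ones, lies between [2 ^ -20] and [2 ^ -19], and an accuracy of [2 ^ -27]
    is enough for its [120] rows; for smaller [d] this eigenvalue is larger and
    fewer bits suffice.  The largest value of [diag] is [2 * 17! * 17 ^ 17],
    about [2 ^ 119], which leaves more than six bits for [scale]. *)
Definition node_of (s : ntriple) : node :=
  let: (i, j, k) := s in
  let g := Z.mul (Z.mul (zfact i) (zfact j)) (zfact k) in
  let diag := Z.mul 2 (Z.mul g (monomial s s)) in
  (s, g, Z.sqrt (Z.div (Z.pow 2 (Z.of_nat (6 * d + 30))) diag)).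

Definition entry (u v : node) : Z :=
  Z.shiftr (Z.mul (Z.mul (scale u) (scale v))
                  (Z.add (weighted u v) (weighted v u)))
           (Z.of_nat (4 * d + 10)).

(** The form of [entry] has to dominate [size l + 1] times the identity:
    [size l] pays for the rounding in [entry], and the rest makes the form
    positive. *)
Definition positive_on (l : seq node) : bool :=
  all (fun u => Z.ltb 0 (scale u)) l &&
  cholesky (Z.pow 2 (Z.of_nat (d + 10))) (size l) (Z.of_nat (size l).+1)
           (gram entry l).

(** Twice the form at [x] is, up to the factor of the shift, the form of
    [entry] at the quotients [x / scale], perturbed by the discarded bits. *)
Lemma weighted_form_gt0 (R : realFieldType) (l : seq node) (x : node -> R) :
  positive_on l -> has (fun u => x u != 0) l ->
  0 < \sum_(u <- l) \sum_(v <- l) Zr R (weighted u v) * (x u * x v).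
Proof.
case/andP=> /allP pos_l chol /hasP[w wl xw_neq0].
set P := Z.pow 2 (Z.of_nat (4 * d + 10)).
have P_gt0 : Z.lt Z0 P by apply: Z.pow_pos_nonneg; lia.
pose K : R := Zr R P.
have K_gt0 : 0 < K by rewrite -[0]/(Zr R Z0); apply/Zr_lt/Z.ltb_lt.
pose s u : R := Zr R (scale u); pose y u := x u / s u.
have s_gt0 u : u \in l -> 0 < s u.
  by move/pos_l => su_gt0; rewrite -[0]/(Zr R Z0); apply: Zr_lt.
pose q u v := Zr R (weighted u v); pose E u v := Zr R (entry u v).
pose e u v := s u * s v * (q u v + q v u) / K - E u v.
have e_le1 u v : `|e u v| <= 1.
  rewrite /e /E /s /q -!ZrM -ZrD -ZrM ler_norml /entry.
  rewrite Z.shiftr_div_pow2 -/P; last by lia.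
  set z := Z.mul _ _.
  have -> : Zr R z / K - Zr R (Z.div z P) = Zr R (Z.modulo z P) / K.
    rewrite {1}(Z_div_mod_eq_full z P) // ZrD ZrM -/K.
    by field; rewrite gt_eqF.
  have [] // := Z.mod_pos_bound z P.
  move/Z.leb_le/(Zr_le R) => mod_ge0; move/Z.ltb_lt/(Zr_lt R) => mod_lt.
  rewrite ler_pdivrMr // ler_pdivlMr // mulN1r mul1r.
  rewrite (ltW mod_lt) andbT; apply: le_trans mod_ge0.
  by rewrite oppr_le0 ltW.
have entryC u v : entry u v = entry v u.
  by rewrite /entry [Z.mul (scale u) _]Z.mul_comm [Z.add _ _]Z.add_comm.
have ysq_gt0 : 0 < \sum_(u <- l) y u ^+ 2.
  have yw_neq0 : y w != 0 by rewrite mulf_neq0 ?invr_eq0 // gt_eqF ?s_gt0.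
  rewrite (perm_big _ (perm_to_rem wl)) big_cons ltr_pwDl //.
    by rewrite exprn_even_gt0.
  by rewrite sumr_ge0 // => u _; rewrite sqr_ge0.
have E_ge : (size l).+1%:R * \sum_(u <- l) y u ^+ 2 <=
            \sum_(u <- l) \sum_(v <- l) E u v * (y u * y v).
  have utE := upper_triangular_gram entry l.
  have := cholesky_sound (x := map y l) utE _ _ chol.
  rewrite size_gram size_map => /(_ erefl erefl).
  by rewrite qform_gram // normsq_map Zr_nat.
have := perturbation_ge y l e_le1.
have -> : \sum_(u <- l) \sum_(v <- l) e u v * (y u * y v) =
  2 / K * (\sum_(u <- l) \sum_(v <- l) q u v * (x u * x v)) -
  \sum_(u <- l) \sum_(v <- l) E u v * (y u * y v).
  have -> : 2 / K * \sum_(u <- l) \sum_(v <- l) q u v * (x u * x v) =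
    \sum_(u <- l) \sum_(v <- l) (q u v + q v u) * (x u * x v) / K.
    set Q := \sum_(u <- l) _.
    have swapQ : Q = \sum_(u <- l) \sum_(v <- l) q v u * (x u * x v).
      rewrite /Q exchange_big; apply: eq_bigr => u _.
      by apply: eq_bigr => v _; rewrite [x u * _]mulrC.
    have -> : 2 / K * Q = Q / K + Q / K by field; rewrite gt_eqF.
    rewrite {2}swapQ !mulr_suml -big_split; apply: eq_bigr => u _.
    rewrite !mulr_suml -big_split; apply: eq_bigr => v _ /=.
    by rewrite !mulrDl.
  rewrite -sumrB; apply: eq_big_seq => u ul; rewrite -sumrB.
  apply: eq_big_seq => v vl; rewrite /e mulrBl; congr (_ - _).
  rewrite /y; field.
  by rewrite !gt_eqF // s_gt0.
set Q := \sum_(u <- l) _; set N := \sum_(u <- l) y u ^+ 2 in ysq_gt0 E_ge *.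
rewrite -natr1 in E_ge => Q_ge.
have : 0 < 2 / K * Q by lra.
by rewrite pmulr_rgt0 // divr_gt0.
Qed.

End Face.

Definition triples (d : nat) : seq ntriple :=
  [seq (i, j, (d - i - j)%N) | i <- iota 0 d.+1, j <- iota 0 (d - i).+1].

(** A relatively open face of the triangle consists of the points with given
    nonzero barycentric coordinates. *)
Definition face_type (s : ntriple) : bool * bool * bool :=
  (0 < s.1.1, 0 < s.1.2, 0 < s.2)%N.

Definition face (d : nat) (F : bool * bool * bool) : seq ntriple :=
  [seq s <- triples d | face_type s == F].

Definition face_types : seq (bool * bool * bool) :=
  let bb := [:: true; false] in
  [seq (p, c) | p <- [seq (a, b) | a <- bb, b <- bb], c <- bb].

Definition faces_positive (d : nat) : bool :=
  let tab := power_table d in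
  all (fun F => positive_on d tab [seq node_of d tab s | s <- face d F])
      face_types.

(** At [d = 18] the symmetric part is no longer positive definite on the open
    triangle. *)
Lemma faces_positive_le17 d : (1 <= d <= 17)%N -> faces_positive d.
Proof.
suff : all faces_positive (iota 1 17).
  by move/allP => pos d_range; apply: pos; rewrite mem_iota.
by vm_cast_no_check (erefl true).
Qed.

(** * P-property of the monomial matrix on a face *)

Lemma nth_powers n a k : (k < n)%N -> nth Z0 (powers n a) k = a ^+ k.
Proof.
rewrite /powers -[a ^+ k]mul1r -[1]/Z.one; move: Z.one => z.
elim: n z k => [|n IHn] z [|k] //=; first by rewrite mulr1.
by rewrite ltnS => /IHn ->; rewrite exprS mulrA [z * a]mulrC.
Qed.

Definition nmonomial (s t : ntriple) : nat :=
  (s.1.1 ^ t.1.1 * s.1.2 ^ t.1.2 * s.2 ^ t.2)%N.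

Lemma tab_powE d a b : (a <= d)%N -> (b <= d)%N ->
  tab_pow (power_table d) a b = Z.of_nat (a ^ b).
Proof.
move=> a_le_d b_le_d; rewrite /tab_pow (nth_map 0%N) ?size_iota //.
by rewrite nth_iota // nth_powers // add0n; lia.
Qed.

Lemma mem_triples d s : (s \in triples d) = (s.1.1 + s.1.2 + s.2 == d)%N.
Proof.
apply/allpairsPdep/idP => [[i [j [+ + ->]]]|].
  by rewrite !mem_iota /=; lia.
case: s => [[i j] k] /eqP /[dup] ijk <-; exists i, j; rewrite !mem_iota.
by split; move: ijk => /=; [lia | lia | move=> _; congr (_, _, _); lia].
Qed.

Lemma uniq_triples d : uniq (triples d).
Proof.
apply: allpairs_uniq_dep; first exact: iota_uniq.
  by move=> i _; exact: iota_uniq.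
by move=> [i j] [i' j'] _ _ /= [-> ->].
Qed.

Lemma monomialE d s t : s \in triples d -> t \in triples d ->
  monomial (power_table d) s t = Z.of_nat (nmonomial s t).
Proof.
rewrite !mem_triples; case: s t => [[i j] k] [[i' j'] k'] /= sd td.
by rewrite /monomial !tab_powE /nmonomial /=; lia.
Qed.

Lemma zfact_gt0 n : Z.ltb 0 (zfact n).
Proof. by elim: n => [//|n IHn]; rewrite /zfact -/(zfact n); lia. Qed.

(** If all the products were nonpositive, their sum with the weights [g] would
    be nonpositive as well, against [weighted_form_gt0]. *)
Lemma face_sign_keeping (R : realFieldType) d F (f : ntriple -> R) :
  (1 <= d <= 17)%N -> has (fun s => f s != 0) (face d F) ->
  exists2 s, s \in face d F &
    0 < f s * \sum_(t <- face d F) (nmonomial s t)%:R * f t.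
Proof.
move=> d_range f_neq0; set tab := power_table d.
have pos_F : positive_on d tab [seq node_of d tab s | s <- face d F].
  move/allP: (faces_positive_le17 d_range); apply.
  by case: F {f_neq0} => [[[] []] []].
have pt_node s : pt (node_of d tab s) = s by case: s => [[]].
have := @weighted_form_gt0 d tab R _ (fun u => f (pt u)) pos_F.
rewrite has_map (eq_has (a2 := fun s => f s != 0)); last first.
  by move=> s /=; rewrite pt_node.
move=> /(_ f_neq0); rewrite big_map => sum_gt0.
apply/hasP; apply: contraLR sum_gt0 => /hasPn none; rewrite -leNgt.
rewrite big_seq; apply: sumr_le0 => s sF; rewrite big_map.
have {none} := none s sF; rewrite -leNgt.
set w := Zr R (weight (node_of d tab s)).
have w_ge0 : 0 <= w.
  rewrite -[0]/(Zr R Z0) /w; apply: Zr_le.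
  case: (s) => [[i j] k] /=; have := zfact_gt0 i; have := zfact_gt0 j.
  by have := zfact_gt0 k; rewrite /weight /=; nia.
move/(ler_wpM2l w_ge0); rewrite mulr0; apply: le_trans.
rewrite !mulr_sumr le_eqVlt; apply/orP; left; apply/eqP.
apply: eq_big_seq => t tF; rewrite /weighted ZrM !pt_node.
move: sF tF; rewrite !mem_filter => /andP[_ sd] /andP[_ td].
by rewrite monomialE // Zr_nat -/w; ring.
Qed.

(** * The Bernstein collocation matrix *)

Definition ntriple_of d (t : triple d) : ntriple :=
  (t.1.1 : nat, t.1.2 : nat, t.2 : nat).

Lemma ntriple_of_inj d : injective (@ntriple_of d).
Proof.
move=> [[i j] k] [[i' j'] k'] [ei ej ek].
by congr (_, _, _); apply: val_inj.
Qed.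

Lemma mem_triples_ntriple_of d (t : triple d) :
  (ntriple_of t \in triples d) = (t \in indices d).
Proof. by rewrite mem_triples inE. Qed.

Definition bernstein_weight (R : realFieldType) d (t : ntriple) : R :=
  d`!%:R / (t.1.1`! * t.1.2`! * t.2`!)%N%:R / d%:R ^+ d.

Lemma bernstein_weight_gt0 (R : realFieldType) d t :
  (0 < d)%N -> 0 < bernstein_weight R d t.
Proof.
by move=> d_gt0; rewrite !divr_gt0 ?exprn_gt0 // ltr0n ?muln_gt0 ?fact_gt0.
Qed.

Lemma bernstein_domain_point (R : realFieldType) d (s t : triple d) :
  (0 < d)%N -> t \in indices d ->
  bernstein t (domain_point R s) =
  bernstein_weight R d (ntriple_of t) *
    (nmonomial (ntriple_of s) (ntriple_of t))%:R.
Proof.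
case: s t => [[i j] k] [[i' j'] k'] d_gt0; rewrite inE /= => /eqP sum_d.
rewrite /bernstein_weight /nmonomial /=.
have -> : d%:R ^+ d = d%:R ^+ i' * d%:R ^+ j' * d%:R ^+ k' :> R.
  by rewrite -!exprD sum_d.
have d_neq0 : d%:R != 0 :> R by rewrite pnatr_eq0 -lt0n.
rewrite !expr_div_n !natrM !natrX; field.
by rewrite !expf_neq0 // !pnatr_eq0 -!lt0n !fact_gt0.
Qed.

Definition face_size (s : ntriple) : nat :=
  ((0 < s.1.1) + (0 < s.1.2) + (0 < s.2))%N.

(** A nonzero [s ^ t] means that the nonzero coordinates of [t] are among those
    of [s]; if [t] has at least as many of them, they are the same. *)
Lemma nmonomial_eq0 s t :
  (face_size s <= face_size t)%N -> face_type t != face_type s ->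
  nmonomial s t = 0%N.
Proof.
case: s t => [[i j] k] [[i' j'] k'].
rewrite /face_size /face_type /nmonomial /=.
case: i => [|i]; case: i' => [|i'];
case: j => [|j]; case: j' => [|j'];
case: k => [|k]; case: k' => [|k'] //= _ _.
all: by rewrite ?expnS ?mul0n ?muln0 ?mul0n.
Qed.

Lemma sum_fibers (R : realFieldType) (I : finType) (J : eqType)
    (h : I -> J) (l : seq J) (g : J -> R) (f : I -> R) :
  uniq l ->
  \sum_(t <- l) g t * \sum_(b | h b == t) f b =
  \sum_(b | h b \in l) g (h b) * f b.
Proof.
elim: l => [|t l IHl] /=; first by rewrite big_nil big_pred0.
case/andP=> tl ul; rewrite big_cons IHl // [RHS](bigID (fun b => h b == t)) /=.
congr (_ + _).
  rewrite mulr_sumr; apply: eq_big => [b|b /eqP-> //].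
  by rewrite inE andbC; case: (h b == t).
apply: eq_bigl => b; rewrite inE.
case: eqP => [->|_] /=; last by rewrite andbT.
by rewrite (negbTE tl).
Qed.

Lemma bernstein_mx_sign_keeping (R : realFieldType) d (G : {set triple d}) :
  (1 <= d <= 17)%N -> G \subset indices d -> sign_keeping (bernstein_mx R G).
Proof.
move=> d_range subG x x_neq0; have d_gt0 : (0 < d)%N by case/andP: d_range.
pose h (a : 'I_#|G|) := ntriple_of (enum_val a).
have h_inj : injective h by move=> a b /ntriple_of_inj/enum_val_inj.
have enumG (a : 'I_#|G|) : enum_val a \in indices d.
  exact: (subsetP subG) (enum_valP a).
have [a1 xa1] : exists a, x a 0 != 0.
  apply/existsP; apply: contra_neqT x_neq0 => /existsPn x0.
  by apply/colP => a; rewrite mxE; apply/eqP; rewrite -[_ == _]negbK x0.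
have [a0 xa0 a0_min] :=
  @arg_minnP _ a1 (fun a => x a 0 != 0) (fun a => face_size (h a)) xa1.
pose F := face_type (h a0).
pose w b := bernstein_weight R d (h b).
have w_gt0 b : 0 < w b by exact: bernstein_weight_gt0.
(* The vector [x], rescaled, as a function on all triples: [h] is injective and
   the sum has at most one term. *)
pose f s := \sum_(b | h b == s) w b * x b 0.
have f_h b : f (h b) = w b * x b 0.
  by rewrite /f (big_pred1 b) // => b'; rewrite (inj_eq h_inj).
have h_face b : (h b \in face d F) = (face_type (h b) == F).
  by rewrite mem_filter mem_triples_ntriple_of enumG andbT.
have f_neq0 : has (fun s => f s != 0) (face d F).
  apply/hasP; exists (h a0); first by rewrite h_face.
  by rewrite f_h mulf_neq0 // gt_eqF.
have [s sF] := face_sign_keeping d_range f_neq0.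
have [fs0|fs_neq0] := eqVneq (f s) 0; first by rewrite fs0 mul0r ltxx.
have [a /eqP def_s | h_s] := pickP (fun b => h b == s); last first.
  by case/eqP: fs_neq0; rewrite /f big_pred0.
move: sF; rewrite -{}def_s h_face f_h => /eqP suppa.
rewrite sum_fibers ?filter_uniq ?uniq_triples // => pos.
exists a; move: pos; rewrite -mulrA pmulr_rgt0 //.
suff -> : \sum_(b | h b \in face d F)
            (nmonomial (h a) (h b))%:R * (w b * x b 0)
          = (bernstein_mx R G *m x) a 0 by [].
rewrite mxE [RHS](bigID (fun b => h b \in face d F)) /=.
rewrite [X in _ = _ + X]big1 ?addr0 => [|b].
  apply: eq_bigr => b _; rewrite mxE bernstein_domain_point //.
  by rewrite mulrA; congr (_ * _); rewrite mulrC.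
rewrite h_face mxE => suppb.
have [->|xb] := eqVneq (x b 0) 0; first by rewrite mulr0.
rewrite bernstein_domain_point // nmonomial_eq0 ?mulr0 ?mul0r //.
  have -> : face_size (ntriple_of (enum_val a)) = face_size (h a0).
    by move: suppa; rewrite /F /face_type /face_size => -[-> -> ->].
  exact: a0_min.
by rewrite -/(h a) -/(h b) suppa.
Qed.

Theorem theorem2 (R : realFieldType) (d : nat) (hd : (1 <= d <= 17)%N)
    (G : {set triple d}) (subG : G \subset indices d) (G_neq0 : G != set0) :
  0 < \det (bernstein_mx R G).
Proof. exact: det_sign_keeping (bernstein_mx_sign_keeping hd subG). Qed.
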